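(* Let $G$ be a real reductive group with identity component $G_0$, let $(\pi,V)$ be an irreducible unitary representation of $G_0$, and let $G_2$ and the coefficients $\beta(x,y)$ (for a fixed choice of normalized intertwining operators $S_x$) be as defined in the context. Let $n=|G_2/G_0|$ and $x,y\in G_2$. Then $$\beta(x,y)^n=1.$$
   Context: A real reductive group is a Lie group $G$ with a compact subgroup $K$, an involution $\theta$ of its Lie algebra $\mathfrak{g}_0$, and a nondegenerate, $\mathrm{Ad}(G)$-invariant, $\theta$-invariant bilinear form on $\mathfrak{g}_0$ such that: $\mathfrak{g}_0$ is a reductive Lie algebra; $\mathfrak{g}_0=\mathfrak{k}_0\oplus\mathfrak{p}_0$ is the decomposition into $\pm1$ eigenspaces of $\theta$, where $\mathfrak{k}_0$ is the Lie algebra of $K$; $\mathfrak{k}_0$ and $\mathfrak{p}_0$ are orthogonal under the form, which is positive definite on $\mathfrak{p}_0$ and negative definite on $\mathfrak{k}_0$; the multiplication map $K\times\exp\mathfrak{p}_0\to G$ is a diffeomorphism onto $G$. It is not required that $\mathrm{Ad}(g)$ be an inner automorphism of $\mathfrak{g}_0\otimes_{\mathbb{R}}\mathbb{C}$. The quotient $G/G_0$ is finite. For $x\in G$ put $\pi^x(g)=\pi(x^{-1}gx)$, $g\in G_0$. $G_2$ is the subgroup of all $x\in G$ for which $\pi^x$ is equivalent to $\pi$. For $x\in G_2$, $n(x)$ is the order of $xG_0$ in $G_2/G_0$ and $h(x)=x^{n(x)}\in G_0$. An operator $S_x$ is a bounded invertible operator on $V$ with $\pi^x(g)S_x=S_x\pi(g)$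 for all $g\in G_0$, normalized so that $\pi(h(x))S_x^{n(x)}=I$. Such operators are fixed for one representative of each class in $G_2/G_0$, with $S_h=\pi(h^{-1})$ for $h\in G_0$, and are extended to all of $G_2$ by $S_{xh}=\pi(h^{-1})S_x$ (equivalently $S_{gx}=S_x\pi(g^{-1})$) for $g,h\in G_0$; they again satisfy the normalization. The coefficients $\beta(x,y)\in\mathbb{C}$ are defined by $S_yS_x=\beta(x,y)S_{xy}$; they depend only on the classes of $x,y$ in $G_2/G_0$. *)

(* Defs.v *)
(* MathComp / MathComp-Analysis *)
From HB Require Import structures.
From mathcomp Require Import all_boot all_order all_algebra.
From mathcomp Require Import all_classical all_reals all_analysis.
From mathcomp.real_closed Require Import complex.

Set Implicit Arguments.
Unset Strict Implicit.
Unset Printing Implicit Defensive.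

Import Order.TTheory GRing.Theory Num.Theory numFieldNormedType.Exports.

Local Open Scope classical_set_scope.
Local Open Scope ring_scope.

(* No axiom relates the two structures here: continuity of the group operations
   is part of [lie_group]. *)
#[short(type="topGroupType")]
HB.structure Definition TopGroup := {G of Group G & Topological G}.

(* Meaningful for U open and V finite dimensional: f is C^(k+1) on U iff it is
   differentiable there and all its directional derivatives are C^k. *)
Fixpoint Ck_on (R : realType) (V W : normedModType R) (k : nat) (f : V -> W)
    (U : set V) : Prop :=
  match k with
  | 0 => forall x, U x -> {for x, continuous f}
  | k'.+1 => (forall x, U x -> differentiable f x) /\
             (forall v, Ck_on k' (fun x => 'D_v f x) U)
  end.

Definition smooth_on (R : realType) (V W : normedModType R) (f : V -> W)
    (U : set V) : Prop :=
  forall k, Ck_on k f U.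

(* [cmap] and [cinv] are total functions, but only their values on [cdom] and
   [ccod] matter. *)
Record chart (R : realType) (d : nat) (M : topologicalType) := Chart {
  cdom : set M;
  cmap :> M -> 'rV[R]_d;
  cinv : 'rV[R]_d -> M;
  ccod := cmap @` cdom;
  cdom_open : open cdom;
  ccod_open : open ccod;
  cmapK : forall x, cdom x -> cinv (cmap x) = x;
  cmap_continuous : {within cdom, continuous cmap};
  cinv_continuous : {within ccod, continuous cinv} }.

Definition smooth_map (R : realType) (d : nat) (M : topologicalType)
    (A : set (chart R d M)) (f : M -> M) : Prop :=
  continuous f /\
  forall a b, A a -> A b ->
    smooth_on (fun u => b (f (cinv a u)))
      [set u | ccod a u /\ cdom b (f (cinv a u))].

(* The chart [chart1] around 1 serves to identify the tangent space of G at 1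
   with 'rV_d; the notions derived from it below do not depend on its choice,
   up to the linear isomorphism given by the change of charts. *)
Record lie_group (R : realType) (d : nat) (G : topGroupType) := LieGroup {
  lie_hausdorff : hausdorff_space G;
  lie_second_countable : @second_countable G;
  atlas : set (chart R d G);
  atlas_cover : forall x : G, exists2 a, atlas a & cdom a x;
  atlas_smooth : smooth_map atlas id;
  lie_mul_continuous : continuous (fun p : G * G => (p.1 * p.2)%g);
  lie_mul_smooth : forall a b c, atlas a -> atlas b -> atlas c ->
    smooth_on (fun uv : 'rV[R]_d * 'rV[R]_d =>
                 c (cinv a uv.1 * cinv b uv.2)%g)
      [set uv | [/\ ccod a uv.1, ccod b uv.2
                  & cdom c (cinv a uv.1 * cinv b uv.2)%g]];
  lie_inv_smooth : smooth_map atlas (fun x : G => x^-1%g);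
  chart1 : chart R d G;
  chart1_atlas : atlas chart1;
  chart1_dom : cdom chart1 1%g }.

Section LieAlgebra.
Context {R : realType} {d : nat} {G : topGroupType} (L : lie_group R d G).
Local Notation phi := (chart1 L).
Local Notation g0 := 'rV[R]_d.

(* The differential at 1 of x |-> g x g^-1. *)
Definition Ad (g : G) (Y : g0) : g0 :=
  'D_Y (fun u : g0 => phi (g * cinv phi u * g^-1)%g) (phi 1%g).

(* ad is the differential at 1 of Ad. *)
Definition bracket (X Y : g0) : g0 :=
  'D_X (fun u : g0 => Ad (cinv phi u) Y) (phi 1%g).

Definition one_parameter_subgroup (X : g0) (c : R -> G) : Prop :=
  [/\ forall s t, c (s + t) = (c s * c t)%g,
      continuous c
    & is_derive (0 : R) 1 (fun t => phi (c t)) X].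

(* The default value 1 is never taken: c exists for every X. *)
Definition lie_exp (X : g0) : G :=
  xget 1%g [set g | exists2 c, one_parameter_subgroup X c & g = c 1].

Definition lie_algebra_of (K : set G) : set g0 :=
  [set X | forall t : R, K (lie_exp (t *: X))].

Definition lie_ideal (a : {vspace g0}) : Prop :=
  forall X Y, Y \in a -> bracket X Y \in a.

Definition reductive_lie_algebra : Prop :=
  forall a : {vspace g0}, lie_ideal a ->
    exists b : {vspace g0},
      [/\ lie_ideal b, (a + b)%VS = fullv & (a :&: b)%VS = 0%VS].

End LieAlgebra.

Definition is_subgroup (G : groupType) (H : set G) : Prop :=
  [/\ H 1%g, forall x y, H x -> H y -> H (x * y)%g
    & forall x, H x -> H (x^-1)%g].

Definition identity_component (G : topGroupType) : set G :=
  connected_component [set: G] 1%g.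
Arguments identity_component G : clear implicits.

Definition left_coset (G : groupType) (N : set G) (x : G) : set G :=
  [set (x * h)%g | h in N].

(* H / N *)
Definition cosets (G : groupType) (H N : set G) : set (set G) :=
  [set left_coset N x | x in H].

(* The multiplication map A x B -> G is a diffeomorphism onto G, smoothness of
   the inverse g |-> (k g, p g) being smoothness as a map into G x G.  If A and
   B contain 1, then k and p are smooth retractions, so that A and B are
   embedded submanifolds and this is smoothness into A x B. *)
Definition mul_diffeomorphism (R : realType) (d : nat) (G : topGroupType)
    (L : lie_group R d G) (A B : set G) : Prop :=
  exists k p : G -> G,
    [/\ smooth_map (atlas L) k, smooth_map (atlas L) p,
        forall g, [/\ A (k g), B (p g) & (k g * p g)%g = g]
      & forall a b, A a -> B b -> k (a * b)%g = a /\ p (a * b)%g = b].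

Record real_reductive (R : realType) (d : nat) (G : topGroupType)
    (L : lie_group R d G) := RealReductive {
  rr_K : set G;
  rr_theta : {linear 'rV[R]_d -> 'rV[R]_d};
  rr_form : {biscalar 'rV[R]_d};
  rr_k0 := [set X | rr_theta X = X];
  rr_p0 := [set X | rr_theta X = - X];
  rr_K_subgroup : is_subgroup rr_K;
  rr_K_compact : compact rr_K;
  rr_thetaK : forall X, rr_theta (rr_theta X) = X;
  rr_theta_bracket : forall X Y,
    rr_theta (bracket L X Y) = bracket L (rr_theta X) (rr_theta Y);
  rr_form_nondegenerate : forall X, (forall Y, rr_form X Y = 0) -> X = 0;
  rr_form_Ad : forall g X Y, rr_form (Ad L g X) (Ad L g Y) = rr_form X Y;
  rr_form_theta : forall X Y,
    rr_form (rr_theta X) (rr_theta Y) = rr_form X Y;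
  rr_reductive : reductive_lie_algebra L;
  rr_k0E : rr_k0 = lie_algebra_of L rr_K;
  rr_orthogonal : forall X Y, rr_k0 X -> rr_p0 Y ->
    rr_form X Y = 0 /\ rr_form Y X = 0;
  rr_form_p0 : forall X, rr_p0 X -> X != 0 -> 0 < rr_form X X;
  rr_form_k0 : forall X, rr_k0 X -> X != 0 -> rr_form X X < 0;
  rr_cartan : mul_diffeomorphism L rr_K (lie_exp L @` rr_p0);
  rr_finite : finite_set (cosets [set: G] (identity_component G)) }.

Section Representations.
Context {R : realType} {G : topGroupType} {V : completeNormedModType R[i]}.

(* Together with completeness of V: the norm of V is a Hilbert space norm. *)
Definition hilbert_product (dot : {dot V for Num.conj}) : Prop :=
  forall v, `|v| ^+ 2 = dot v v.

Definition bounded_operator (T : V -> V) : Prop :=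
  linear T /\ exists M : R[i], forall v, `|T v| <= M * `|v|.

Definition bounded_invertible (T : V -> V) : Prop :=
  bounded_operator T /\
  exists T', [/\ bounded_operator T', cancel T T' & cancel T' T].

(* Representations of a subgroup H are total functions on G of which only the
   values on H matter.  The operators pi g, g in H, are surjective because
   pi (g^-1) is inverse to pi g. *)
Record unitary_representation (dot : {dot V for Num.conj}) (H : set G)
    (pi : G -> V -> V) : Prop := UnitaryRepresentation {
  rep_linear : forall g, H g -> linear (pi g);
  rep1 : forall v, pi 1%g v = v;
  repM : forall g h, H g -> H h -> forall v, pi (g * h)%g v = pi g (pi h v);
  rep_unitary : forall g, H g -> forall v w, dot (pi g v) (pi g w) = dot v w;
  rep_continuous : forall v, {within H, continuous (fun g => pi g v)} }.

Definition irreducible_representation (H : set G) (pi : G -> V -> V) : Prop :=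
  (exists v : V, v != 0) /\
  forall W : set V, W 0 -> (forall (c : R[i]) v w, W v -> W w -> W (c *: v + w)) ->
    closed W -> (forall g v, H g -> W v -> W (pi g v)) ->
    W = [set 0] \/ W = [set: V].

Definition intertwines (H : set G) (pi1 pi2 : G -> V -> V) (T : V -> V) : Prop :=
  forall g, H g -> forall v, pi2 g (T v) = T (pi1 g v).

Definition equivalent_representations (H : set G) (pi1 pi2 : G -> V -> V) : Prop :=
  exists2 T, bounded_invertible T & intertwines H pi1 pi2 T.

(* pi^x *)
Definition twist (pi : G -> V -> V) (x : G) : G -> V -> V :=
  fun g => pi (x^-1 * g * x)%g.

Definition G2 (pi : G -> V -> V) : set G :=
  [set x | equivalent_representations (identity_component G) (twist pi x) pi].

(* m is the order of the class of x modulo N *)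
Definition is_coset_order (N : set G) (x : G) (m : nat) : Prop :=
  [/\ (0 < m)%N, N (x ^+ m)%g
    & forall j, (0 < j < m)%N -> ~ N (x ^+ j)%g].

(* T is the set of chosen representatives of the classes of G2 / G0.  The
   normalization is only imposed on these. *)
Record normalized_intertwiners (pi : G -> V -> V) (S : G -> V -> V) : Prop :=
  NormalizedIntertwiners {
  ni_representatives : exists T : set G,
    [/\ T `<=` G2 pi,
        forall x, G2 pi x ->
          exists! t, T t /\ left_coset (identity_component G) t x
      & forall t, T t ->
        [/\ bounded_invertible (S t),
            intertwines (identity_component G) pi (twist pi t) (S t)
          & forall m, is_coset_order (identity_component G) t m ->
              forall v, pi (t ^+ m)%g (iter m (S t) v) = v]];
  ni_G0 : forall h, identity_component G h -> forall v, S h v = pi (h^-1)%g v;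
  ni_extension : forall x h, G2 pi x -> identity_component G h ->
    forall v, S (x * h)%g v = pi (h^-1)%g (S x v) }.

End Representations.

(* Main.v *)
Require Import Defs.
From mathcomp Require Import all_boot all_order all_algebra.
From mathcomp Require Import perm.
From mathcomp Require Import all_classical all_reals all_analysis.
From mathcomp.real_closed Require Import complex.

Import Order.TTheory GRing.Theory Num.Theory numFieldNormedType.Exports.

Local Open Scope classical_set_scope.
Local Open Scope card_scope.
Local Open Scope ring_scope.

(** Write N for the identity component, H for G_2, and let
    f(x) = prod_z beta(x, z), the product being taken over the n classes z of
    H / N.  Composing S_z, S_y and S_x in two ways gives the cocycle identity
      beta(x, y) beta(xy, z) = beta(y, z) beta(x, yz),
    and multiplying it over all classes z, where yz runs over the classes as
    well, gives
      beta(x, y)^n f(xy) = f(y) f(x).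
    So it suffices that f is identically 1, which is where the normalization of
    the operators enters.  As beta, and hence f, depends on classes only, x may
    be taken among the representatives for which the normalization is imposed.
    Let m be the order of xN.  Left multiplication by x permutes the classes in
    cycles z, xz, ..., x^(m-1) z, all of length m, and on the one hand
      S_z S_x^m = beta(x, z) beta(x, xz) ... beta(x, x^(m-1) z) S_(x^m z),
    on the other hand S_x^m = pi(x^m)^-1 and x^m lies in N, so that
    S_z S_x^m = S_(x^m z).  Every cycle therefore contributes 1 to f(x).

    The combinatorial half is [cocycle_expn], a statement about any function
    beta with these properties; [beta_cocycle], [beta_coset] and
    [prod_beta_cycle] establish the properties for the coefficients at hand.
    N is a normal subgroup by the continuity of the multiplication, and scalars
    can be compared because the operators S_x are injective on the nonzero
    space V. *)

(** * Products over the cosets of a normal subgroup *)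

Definition normal_in {G : groupType} (N : set G) : Prop :=
  forall x h, N h -> N (x^-1 * h * x)%g.

Definition coset_invariant {G : groupType} {T : Type} (N H : set G)
    (F : G -> T) : Prop :=
  forall x y, H x -> H y -> N (x^-1 * y)%g -> F x = F y.

Definition transversal {G : groupType} (N H : set G) {n : nat}
    (r : 'I_n -> G) : Prop :=
  (forall i, H (r i)) /\ forall z, H z -> exists! i, N ((r i)^-1 * z)%g.

(** The order of the class of x in G / N for an abstract group G; on a
    topological group it is convertible to [is_coset_order]. *)
Definition coset_order {G : groupType} (N : set G) (x : G) (m : nat) : Prop :=
  [/\ (0 < m)%N, N (x ^+ m)%g & forall j, (0 < j < m)%N -> ~ N (x ^+ j)%g].

Lemma left_cosetE {G : groupType} (N : set G) (x y : G) :
  left_coset N x y = N (x^-1 * y)%g.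
Proof.
apply/propext; split; first by case=> h Nh <-; rewrite mulKg.
by move=> Nxy; exists (x^-1 * y)%g => //; rewrite mulVKg.
Qed.

Section Cosets.
Context {G : groupType} {N H : set G}.
Hypothesis sgN : is_subgroup N.
Hypothesis nN : normal_in N.
Hypothesis mulH : forall x y, H x -> H y -> H (x * y)%g.

Lemma subgroup_divC {x y} : N (x^-1 * y)%g -> N (y^-1 * x)%g.
Proof. by case: sgN => _ _ NV /NV; rewrite invgM invgK. Qed.

Lemma subgroup_div_trans y {x z} :
  N (x^-1 * y)%g -> N (y^-1 * z)%g -> N (x^-1 * z)%g.
Proof.
by case: sgN => _ NM _ Nxy Nyz; have := NM _ _ Nxy Nyz; rewrite -mulgA mulVKg.
Qed.

Lemma left_coset_eqP {x y} : left_coset N x = left_coset N y <-> N (x^-1 * y)%g.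
Proof.
have [N1 _ _] := sgN; split=> [exy|Nxy].
  by rewrite -left_cosetE exy left_cosetE mulVg.
apply/seteqP; split=> z; rewrite !left_cosetE; last exact: subgroup_div_trans.
by apply: subgroup_div_trans; apply: subgroup_divC.
Qed.

Lemma transversal_exists {n} : cosets H N #= `I_n ->
  exists r : 'I_n -> G, transversal N H r.
Proof.
rewrite card_eq_sym => /card_set_bijP[c [cH cinj csurj]].
have /choice[r Hr] : forall i : 'I_n, exists x, H x /\ left_coset N x = c i.
  by move=> i; have [x Hx <-] := cH i (ltn_ord i); exists x.
exists r; split=> [i|z Hz]; first by case: (Hr i).
have [i ltin ci] : (c @` `I_n) (left_coset N z) by apply: csurj; exists z.
exists (Ordinal ltin); split.
  by apply/left_coset_eqP; case: (Hr (Ordinal ltin)) => _ ->.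
move=> j /left_coset_eqP; case: (Hr j) => _ -> cj.
by apply/val_inj/cinj; rewrite ?inE //= ci cj.
Qed.

Context {n : nat} {r : 'I_n -> G}.
Hypothesis rT : transversal N H r.

(** Left multiplication by y is injective on the cosets in H, and there are
    finitely many of them; so it permutes them although H is only assumed to be
    closed under products. *)
Lemma translation_perm {y} : H y ->
  exists s : {perm 'I_n}, forall i, N ((r (s i))^-1 * (y * r i))%g.
Proof.
case: rT => Hr Er Hy.
have /choice[s Hs] : forall i, exists j, N ((r j)^-1 * (y * r i))%g.
  by move=> i; have [j [Nj _]] := Er _ (mulH _ _ Hy (Hr i)); exists j.
have sI : injective s.
  move=> i j sij; have := Hs j; rewrite -sij => /subgroup_divC Hj.
  have := subgroup_div_trans _ Hj (Hs i).
  rewrite invgM -mulgA mulKg => Nji.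
  have [k [_ kP]] := Er _ (Hr i).
  have [N1 _ _] := sgN.
  by rewrite -(kP j Nji) -(kP i) // mulVg.
by exists (perm sI) => i; rewrite permE.
Qed.

Lemma prod_translate {K : comNzRingType} (F : G -> K) {y} :
  coset_invariant N H F -> H y ->
  \prod_(i < n) F (y * r i)%g = \prod_(i < n) F (r i).
Proof.
move=> FN Hy; have [s Hs] := translation_perm Hy.
case: rT => Hr _; rewrite [RHS](reindex_perm s); apply: eq_bigr => i _.
by apply/esym/FN => //; apply: mulH.
Qed.

(** The translation by x decomposes the cosets into cycles, all of whose lengths
    are the order of x modulo N; so a product over the cosets is trivial as soon
    as the product along each cycle is. *)
Lemma prod_cycles {K : comNzRingType} (F : G -> K) {x} :
  coset_invariant N H F -> H x ->
  (forall m z, coset_order N x m -> H z ->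
     \prod_(j < m) F (x ^+ j * z)%g = 1) ->
  \prod_(i < n) F (r i) = 1.
Proof.
move=> FN Hx Fcyc; have [s Hs] := translation_perm Hx.
have [Hr Er] := rT; have [N1 _ _] := sgN.
have Hxr j i : H (x ^+ j * r i)%g.
  by elim: j => [|j IHj]; rewrite ?mul1g ?expgS -?mulgA; [|exact: mulH].
have iterN j i : N ((r (iter j s i))^-1 * (x ^+ j * r i))%g.
  elim: j => [|j IHj]; first by rewrite mul1g mulVg.
  apply: (subgroup_div_trans _ (Hs _)).
  by rewrite invgM expgS -!mulgA mulKg.
(* A power of s fixes an index exactly when that power of x lies in N. *)
have fixP j i : iter j s i = i <-> N (x ^+ j)%g.
  have -> : N (x ^+ j)%g <-> N ((r i)^-1 * (x ^+ j * r i))%g.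
    split=> [/(nN (r i))|/(nN (r i)^-1%g)]; first by rewrite mulgA.
    by rewrite invgK mulVKg mulgK.
  split=> [{1}<-|Ni]; first exact: iterN.
  by have [k [_ kP]] := Er _ (Hxr j i); rewrite -(kP _ (iterN j i)) -(kP i).
rewrite (partition_big (porbit s) [in porbits s]) /=; last first.
  by move=> i _; apply: imset_f.
apply: big1 => _ /imsetP[i0 _ ->].
rewrite (eq_bigl [in traject s i0 #|porbit s i0|]); last first.
  by move=> i; rewrite eq_porbit_mem porbit_traject.
rewrite -big_uniq ?uniq_traject_porbit //=; set m := #|porbit s i0|.
rewrite (big_nth i0) size_traject big_mkord -[RHS](Fcyc m (r i0)) //.
  apply: eq_bigr => j _; rewrite nth_traject //.
  exact: FN.
split; [by rewrite lt0n card_porbit_neq0|by apply/(fixP _ i0)/iter_porbit|].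
move=> j /andP[j0 jm] /(fixP _ i0) fixj.
have := uniq_traject_porbit s i0; rewrite -/m => /(nth_uniq i0).
rewrite size_traject => /(_ 0%N j (ltn_trans j0 jm) jm).
rewrite !nth_traject ?fixj ?eqxx ?(ltn_trans j0 jm) // => /esym/eqP j00.
by rewrite -j00 in j0.
Qed.

End Cosets.

(** Multiplying the cocycle identity over all cosets z exhibits the n-th power
    of a 2-cocycle beta as the coboundary of x |-> \prod_z beta x z.  This
    function only depends on the coset of x, and the hypothesis on cycles makes
    it trivial on one element t of each coset. *)
Lemma cocycle_expn {G : groupType} {K : comNzRingType} {N H : set G}
    {n : nat} {beta : G -> G -> K} :
  is_subgroup N -> normal_in N ->
  (forall x y, H x -> H y -> H (x * y)%g) ->
  cosets H N #= `I_n ->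
  (forall x x' y y', H x -> H x' -> H y -> H y' ->
     N (x^-1 * x')%g -> N (y^-1 * y')%g -> beta x y = beta x' y') ->
  (forall x y z, H x -> H y -> H z ->
     beta x y * beta (x * y)%g z = beta y z * beta x (y * z)%g) ->
  (forall x, H x -> exists2 t, H t /\ N (t^-1 * x)%g &
     forall m z, coset_order N t m -> H z ->
       \prod_(j < m) beta t (t ^+ j * z)%g = 1) ->
  forall x y, H x -> H y -> beta x y ^+ n = 1.
Proof.
move=> sgN nN mulH /(transversal_exists sgN)[r rT] betaN cocycle cyc x y Hx Hy.
have [N1 _ _] := sgN; have Hr := rT.1.
have inv2 u : H u -> coset_invariant N H (beta u).
  by move=> Hu a b Ha Hb Nab; apply: betaN; rewrite ?mulVg.
have f1 u : H u -> \prod_(i < n) beta u (r i) = 1.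
  move=> Hu; have [t [Ht Ntu] tcyc] := cyc u Hu.
  rewrite -[RHS](prod_cycles sgN nN mulH rT _ (inv2 t Ht) Ht tcyc).
  apply: eq_bigr => i _; apply: betaN; rewrite ?mulVg //.
  exact: subgroup_divC.
have /eqP := erefl (\prod_(i < n) (beta x y * beta (x * y)%g (r i))).
(* On one side only, so that the trivial equation becomes the identity above. *)
rewrite {2}(eq_bigr _ (fun i _ => cocycle x y (r i) Hx Hy (Hr i))).
have Hxy := mulH x y Hx Hy.
rewrite !big_split /= (prod_translate sgN mulH rT _ (inv2 x Hx) Hy) !f1 //.
by rewrite big_const_ord iter_mulr_1 !mulr1 => /eqP.
Qed.

(** * The identity component *)

Section IdentityComponent.
Context {R : realType} {d : nat} {G : topGroupType} (L : lie_group R d G).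
Local Notation G0 := (identity_component G).

Lemma continuous_mull (x : G) : continuous (fun y : G => (x * y)%g).
Proof.
move=> y; apply: (@continuous_comp G (G * G)%type G (pair x)
  (fun p => (p.1 * p.2)%g)).
  by apply: cvg_pair; [exact: cvg_cst|exact: cvg_id].
exact: (lie_mul_continuous L).
Qed.

Lemma continuous_mulr (x : G) : continuous (fun y : G => (y * x)%g).
Proof.
move=> y; apply: (@continuous_comp G (G * G)%type G (pair^~ x)
  (fun p => (p.1 * p.2)%g)).
  by apply: cvg_pair; [exact: cvg_id|exact: cvg_cst].
exact: (lie_mul_continuous L).
Qed.

(** The image of the identity component is connected and contains 1. *)
Lemma identity_component_image (f : G -> G) {h : G} :
  continuous f -> G0 h -> f h = 1%g -> forall y, G0 y -> G0 (f y).
Proof.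
move=> cf G0h fh1 y G0y.
apply: (@connected_component_max _ _ (f @` G0)) => //.
- by exists h.
- apply: connected_continuous_connected; first exact: component_connected.
  exact: continuous_subspaceT.
Qed.

Lemma identity_component_subgroup : is_subgroup G0.
Proof.
have G01 : G0 1%g by apply: connected_component_refl.
have divG0 x y : G0 x -> G0 y -> G0 (x^-1 * y)%g.
  move=> G0x; apply: (identity_component_image (fun z => x^-1 * z)%g _ G0x);
    last exact: mulVg.
  exact: continuous_mull.
have invG0 x : G0 x -> G0 x^-1%g.
  by move=> G0x; rewrite -[(x^-1)%g]mulg1; apply: divG0.
by split=> // x y G0x G0y; rewrite -[x]invgK; apply: divG0 => //; apply: invG0.
Qed.

Lemma identity_component_normal : normal_in G0.
Proof.
move=> x h; have [G01 _ _] := identity_component_subgroup.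
apply: (identity_component_image (fun z => x^-1 * z * x)%g _ G01);
  last by rewrite mulg1 mulVg.
move=> y; apply: (@continuous_comp G G G (fun z => (x^-1 * z)%g)
  (fun z => (z * x)%g)); first exact: continuous_mull.
exact: continuous_mulr.
Qed.

End IdentityComponent.

(** * Intertwining operators *)

Section Operators.
Context {R : realType} {V : completeNormedModType R[i]}.

Lemma linear_scale {T : V -> V} : linear T ->
  forall (a : R[i]) v, T (a *: v) = a *: T v.
Proof. by move=> lT a v; exact: (scalable_linear lT). Qed.

Lemma bounded_operator_comp (T1 T2 : V -> V) :
  bounded_operator T1 -> bounded_operator T2 -> bounded_operator (T1 \o T2).
Proof.
move=> [lT1 [M1 T1M]] [lT2 [M2 T2M]]; split.
  by move=> c u v /=; rewrite lT2 lT1.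
(* If V = 0 then M1 may be any complex number; its norm is a bound anyway. *)
have T1M' v : `|T1 v| <= `|M1| * `|v|.
  have M1v : 0 <= M1 * `|v| by apply: le_trans (T1M v).
  by apply: le_trans (T1M v) _; rewrite -{1}(ger0_norm M1v) normrM normr_id.
exists (`|M1| * M2) => v; apply: le_trans (T1M' _) _.
by rewrite -mulrA ler_wpM2l.
Qed.

Lemma bounded_invertible_comp (T1 T2 : V -> V) :
  bounded_invertible T1 -> bounded_invertible T2 ->
  bounded_invertible (T1 \o T2).
Proof.
move=> [bT1 [U1 [bU1 TK1 UK1]]] [bT2 [U2 [bU2 TK2 UK2]]].
split; first exact: bounded_operator_comp.
exists (U2 \o U1); split; first exact: bounded_operator_comp.
- exact: can_comp.
- exact: can_comp.
Qed.

End Operators.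

Section Intertwiners.
Context {R : realType} {G : topGroupType} {V : completeNormedModType R[i]}.
Local Notation G0 := (identity_component G).
Context {dot : {dot V for Num.conj}} { pi : G -> V -> V} {S : G -> V -> V}.
Hypothesis sgN : is_subgroup G0.
Hypothesis nN : normal_in G0.
Hypothesis Hpi : unitary_representation dot G0 pi.
Hypothesis HS : normalized_intertwiners pi S.
Local Notation H := (G2 pi).

(** If T_x and T_y realize the equivalence of pi^x and of pi^y with pi, then
    T_x T_y does so for pi^(xy) = (pi^y)^x, since T_y also intertwines (pi^y)^x
    and pi^x. *)
Lemma G2_mul {x y} : H x -> H y -> H (x * y)%g.
Proof.
move=> [Tx bTx iTx] [Ty bTy iTy]; exists (Tx \o Ty).
  exact: bounded_invertible_comp.
move=> g Ng v /=; rewrite iTx //; congr Tx.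
rewrite /twist iTy; last exact: nN.
by rewrite /twist invgM !mulgA.
Qed.

Lemma repK {h} : G0 h -> cancel (pi h) (pi (h^-1)%g).
Proof.
move=> Nh v; have [_ _ /(_ h Nh) NV] := sgN.
by rewrite -(repM Hpi) // mulVg (rep1 Hpi).
Qed.

Lemma representative_exists {x} : H x -> exists2 t,
  [/\ H t, G0 (t^-1 * x)%g, bounded_invertible (S t) &
      intertwines G0 pi (twist pi t) (S t)] &
  forall m, is_coset_order G0 t m ->
    forall v, pi (t ^+ m)%g (iter m (S t) v) = v.
Proof.
move=> Hx; have [T [TG2 Tex TP]] := ni_representatives HS.
have [t [[Tt tx] _]] := Tex x Hx; have [bS iS nS] := TP t Tt.
by exists t => //; split=> //; [exact: TG2|rewrite -left_cosetE].
Qed.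

(** The properties are given for representatives t of the classes; they pass to
    x = th because S_x = pi(h^-1) S_t. *)
Lemma S_linear_injective_intertwines {x} : H x ->
  [/\ linear (S x), injective (S x) & intertwines G0 pi (twist pi x) (S x)].
Proof.
move=> Hx.
have [t [Ht Nh [[lS _] [U [_ SK _]]] iS] _] := representative_exists Hx.
set h := (t^-1 * x)%g in Nh; have [_ _ NV] := sgN.
have xth : x = (t * h)%g by rewrite mulVKg.
clearbody h.
have SxE v : S x v = pi (h^-1)%g (S t v) by rewrite xth (ni_extension HS).
have Nh' := NV _ Nh; split.
- by move=> c u v; rewrite !SxE lS (rep_linear Hpi).
- move=> u v; rewrite !SxE => /(can_inj (repK Nh')).
  exact: (can_inj SK).
- move=> g Ng v; rewrite !SxE -iS // /twist.
  rewrite -!(repM Hpi) //; try exact: nN.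
  by rewrite xth invgM !mulgA !mulgK.
Qed.

Lemma S_pi {x h} : H x -> G0 h ->
  forall v, S x (pi h v) = pi (x^-1 * h * x)%g (S x v).
Proof.
move=> Hx Nh v; have [_ _ iS] := S_linear_injective_intertwines Hx.
by rewrite -iS.
Qed.

Context {beta : G -> G -> R[i]}.
Hypothesis V_neq0 : exists v : V, v != 0.
Hypothesis Hbeta : forall x y, H x -> H y ->
  forall v, S y (S x v) = beta x y *: S (x * y)%g v.

Lemma S_scale_inj x (a b : R[i]) : H x ->
  (forall v, a *: S x v = b *: S x v) -> a = b.
Proof.
move=> Hx eab; have [v vN0] := V_neq0.
have [lS iS _] := S_linear_injective_intertwines Hx.
have Sv : S x v != 0.
  have S0 : S x 0 = 0 by have := linear_scale lS 0 0; rewrite !scale0r.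
  by apply: contraNneq vN0 => Sv0; apply/eqP/iS; rewrite Sv0 S0.
apply/eqP; rewrite -subr_eq0; have /eqP := eab v.
by rewrite -subr_eq0 -scalerBl scaler_eq0 (negPf Sv) orbF.
Qed.

(** Associativity of the composition of S_x, S_y and S_z. *)
Lemma beta_cocycle x y z : H x -> H y -> H z ->
  beta x y * beta (x * y)%g z = beta y z * beta x (y * z)%g.
Proof.
move=> Hx Hy Hz; apply: (@S_scale_inj (x * (y * z))%g) => [|v].
  by do 2?apply: G2_mul.
have [/linear_scale SzZ _ _] := S_linear_injective_intertwines Hz.
rewrite -!scalerA -(Hbeta _ _ Hx (G2_mul Hy Hz)) -(Hbeta _ _ Hy Hz).
rewrite (Hbeta _ _ Hx Hy).
by rewrite SzZ mulgA Hbeta //; apply: G2_mul.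
Qed.

(** Replacing x by xh and y by yk multiplies both S_y S_x and S_(xy) on the left
    by pi(l^-1), where l = (y^-1 h y) k. *)
Lemma beta_coset x x' y y' : H x -> H x' -> H y -> H y' ->
  G0 (x^-1 * x')%g -> G0 (y^-1 * y')%g -> beta x y = beta x' y'.
Proof.
move=> Hx Hx' Hy Hy' Nh Nk; have [_ NM NV] := sgN.
have [h {}Nh Ex] : exists2 h, G0 h & x' = (x * h)%g.
  by exists (x^-1 * x')%g; rewrite ?mulVKg.
have [k {}Nk Ey] : exists2 k, G0 k & y' = (y * k)%g.
  by exists (y^-1 * y')%g; rewrite ?mulVKg.
have Hxy := G2_mul Hx Hy.
set l := (y^-1 * h * y * k)%g.
have Nl : G0 l by apply: NM => //; apply: nN.
have Exy : (x' * y')%g = (x * y * l)%g by rewrite Ex Ey !mulgA !mulgK.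
apply: (@S_scale_inj (x' * y')%g) => [|v]; first exact: G2_mul.
rewrite -(Hbeta _ _ Hx' Hy') Exy Ex Ey (ni_extension HS Hxy Nl).
rewrite (ni_extension HS Hx Nh) (ni_extension HS Hy Nk).
rewrite (S_pi Hy (NV _ Nh)) (Hbeta _ _ Hx Hy).
rewrite -(repM Hpi (NV _ Nk) (nN _ _ (NV _ Nh))).
rewrite -(linear_scale (rep_linear Hpi (NV _ Nl))).
by rewrite /l !invgM invgK !mulgA.
Qed.

Lemma G2_expMl x z m : H x -> H z -> H (x ^+ m * z)%g.
Proof.
move=> Hx Hz; elim: m => [|m IHm]; first by rewrite mul1g.
by rewrite expgS -mulgA; apply: G2_mul.
Qed.

Lemma S_iter x z m v : H x -> H z ->
  S z (iter m (S x) v) =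
  (\prod_(j < m) beta x (x ^+ j * z)%g) *: S (x ^+ m * z)%g v.
Proof.
move=> Hx Hz; elim: m v => [|m IHm] v; first by rewrite big_ord0 scale1r mul1g.
have Hxz := G2_expMl x z m Hx Hz.
by rewrite iterSr IHm Hbeta // scalerA big_ord_recr /= expgS -mulgA.
Qed.

(** If m is the order of t modulo G_0 then t^m z = z (z^-1 t^m z), so that both
    S_z S_t^m and S_(t^m z) equal S_z pi(t^m)^-1. *)
Lemma prod_beta_cycle t z m : H t -> H z -> is_coset_order G0 t m ->
  (forall v, pi (t ^+ m)%g (iter m (S t) v) = v) ->
  \prod_(j < m) beta t (t ^+ j * z)%g = 1.
Proof.
move=> Ht Hz [_ Ntm _] nS; have [_ _ NV] := sgN.
apply: (@S_scale_inj (t ^+ m * z)%g) => [|v]; first exact: G2_expMl.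
rewrite -S_iter // scale1r.
have -> : iter m (S t) v = pi ((t ^+ m)^-1)%g v by rewrite -{2}(nS v) repK.
rewrite S_pi //; last exact: NV.
have -> : (t ^+ m * z)%g = (z * (z^-1 * t ^+ m * z))%g.
  by rewrite !mulgA mulgV mul1g.
rewrite (ni_extension HS) //; last exact: nN.
by rewrite !invgM invgK !mulgA.
Qed.

End Intertwiners.

(** * Triviality of the n-th power *)

Theorem proposition3 (R : realType) (d : nat) (G : topGroupType)
    (L : lie_group R d G) (HG : real_reductive L)
    (V : completeNormedModType R[i]) (dot : {dot V for Num.conj})
    (Hdot : hilbert_product dot)
    (pi : G -> V -> V)
    (Hpi : unitary_representation dot (identity_component G) pi)
    (Hirr : irreducible_representation (identity_component G) pi)
    (S : G -> V -> V) (HS : normalized_intertwiners pi S)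
    (beta : G -> G -> R[i])
    (Hbeta : forall x y, G2 pi x -> G2 pi y ->
       forall v, S y (S x v) = beta x y *: S (x * y)%g v)
    (n : nat) (Hn : cosets (G2 pi) (identity_component G) #= `I_n)
    (x y : G) (Hx : G2 pi x) (Hy : G2 pi y) :
  beta x y ^+ n = 1.
Proof.
have sgN := identity_component_subgroup L.
have nN := identity_component_normal L.
have V0 := Hirr.1.
have mulG2 a b : G2 pi a -> G2 pi b -> G2 pi (a * b)%g by apply: G2_mul.
apply: (cocycle_expn sgN nN mulG2 Hn _ _ _ x y Hx Hy).
- by move=> a a' b b'; apply: (beta_coset sgN nN Hpi HS V0 Hbeta).
- by move=> a b c; apply: (beta_cocycle sgN nN Hpi HS V0 Hbeta).
- move=> a Ha; have [t [Ht Nt _ _] nS] := representative_exists HS Ha.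
  exists t => // m z ord_m Hz.
  by apply: (prod_beta_cycle sgN nN Hpi HS V0 Hbeta) => //; apply: nS.
Qed.
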